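(* Let $r\ge2$. For any non-empty index $\underline{a}=(a_1,\ldots,a_m)\in\mathbb{N}^m$ and any $\mathbf{z}=(z_1,\ldots,z_{r-1},z_r=1)\in\Omega^r$, with $\mathbf{z}'=(z_2,\ldots,z_r)\in\Omega^{r-1}$, \[ E_r(\underline{a};\mathbf{z})=E_{r-1}(\underline{a};\mathbf{z}')+\sum_{i=1}^{m}E_{r-1}(\underline{a}^{(i)};\mathbf{z}')\sum_{\substack{f_1,\ldots,f_i\in A_+\\ \deg f_1>\cdots>\deg f_i\ge0}}G_{a_1}^{\Lambda_{\mathbf{z}'}}\big(t_{\Lambda_{\mathbf{z}'}}(f_1z_1)\big)\cdots G_{a_i}^{\Lambda_{\mathbf{z}'}}\big(t_{\Lambda_{\mathbf{z}'}}(f_iz_1)\big). \]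
   Context: Basic notation. $q$ is a power of a prime $p$, $A=\mathbb{F}_q[\theta]$, $K=\mathbb{F}_q(\theta)$, $K_\infty$ is the completion of $K$ at the infinite place with $|\theta|=q$, and $\mathbb{C}_\infty$ is the completion of an algebraic closure of $K_\infty$. $A_+$ is the set of monic polynomials in $A$; $\mathbb{N}$ is the set of positive integers. For $r\ge1$, $\Omega^r=\{(z_1,\ldots,z_r)\in\mathbb{C}_\infty^r: z_1,\ldots,z_r\ K_\infty\text{-linearly independent},\ z_r=1\}$. For an index $\underline{a}=(a_1,\ldots,a_m)$, $\underline{a}^{(i)}=(a_{i+1},\ldots,a_m)$ for $0\le i\le m-1$ and $\underline{a}^{(m)}=\emptyset$. Order. For $\boldsymbol{f}\in A^r$, $\mathbf{z}\in\Omega^r$ put $\langle\boldsymbol{f},\mathbf{z}\rangle=\sum_i f_iz_i$. Define $\langle\boldsymbol{f},\mathbf{z}\rangle\succ0$ if $f_1=\cdots=f_{i-1}=0$ and $f_i\in A_+$ for some $1\le i\le r$. For $\langle\boldsymbol{f},\mathbf{z}\rangle,\langle\boldsymbol{g},\mathbf{z}\rangle\succ0$, write $\langle\boldsymbol{f},\mathbf{z}\rangle\succ\langle\boldsymbol{g},\mathbf{z}\rangle$ if there is $1\le i\le r$ with $f_1=\cdots=f_{i-1}=g_1=\cdots=g_{i-1}=0$ and either ($f_i,g_i\in A_+$ and $\deg f_i>\deg g_i$) or ($f_i\in A_+$ and $g_i=0$). Multiple Eisenstein series of rank $r$: for non-empty $\underline{a}=(a_1,\ldots,a_m)$, \[ E_r(\underline{a};\mathbf{z})=\sum_{\substack{\boldsymbol{f}_1,\ldots,\boldsymbol{f}_m\in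 A^r\\ \langle\boldsymbol{f}_1,\mathbf{z}\rangle\succ\cdots\succ\langle\boldsymbol{f}_m,\mathbf{z}\rangle\succ0}}\frac{1}{\langle\boldsymbol{f}_1,\mathbf{z}\rangle^{a_1}\cdots\langle\boldsymbol{f}_m,\mathbf{z}\rangle^{a_m}},\qquad E_r(\emptyset;\mathbf{z})=1. \] Goss polynomials. For $s\ge 1$ and $\mathbf{w}=(w_1,\ldots,w_s)\in\Omega^s$ let $\Lambda_{\mathbf{w}}=Aw_1+\cdots+Aw_s\subset\mathbb{C}_\infty$, $\exp_{\Lambda_{\mathbf{w}}}(x)=x\prod_{0\ne\lambda\in\Lambda_{\mathbf{w}}}(1-x/\lambda)$, and $t_{\Lambda_{\mathbf{w}}}(x)=\exp_{\Lambda_{\mathbf{w}}}(x)^{-1}=\sum_{\lambda\in\Lambda_{\mathbf{w}}}\frac{1}{x+\lambda}$. For $k\ge1$, the Goss polynomial $G_k^{\Lambda_{\mathbf{w}}}\in\mathbb{C}_\infty[x]$ is the polynomial satisfying $G_k^{\Lambda_{\mathbf{w}}}(t_{\Lambda_{\mathbf{w}}}(x))=\sum_{\lambda\in\Lambda_{\mathbf{w}}}\frac{1}{(x+\lambda)^k}$ for $x\in\mathbb{C}_\infty\setminus\Lambda_{\mathbf{w}}$ (its existence is a known theorem of Goss). *)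

(* Defs.v *)
From mathcomp Require Import all_boot all_order all_algebra.
From mathcomp Require Import fraction finmap.
From mathcomp Require Import boolp classical_sets reals.

Set Implicit Arguments.
Unset Strict Implicit.
Unset Printing Implicit Defensive.

Import Order.TTheory GRing.Theory Num.Theory.

Local Open Scope classical_set_scope.
Local Open Scope ring_scope.

(* Here A is {poly F}, K is {fraction {poly F}} and q is #|F|. *)

Section ValuedExtension.

Variables (R : realType) (F : finFieldType) (C : fieldType).
Variables (iota : {rmorphism {fraction {poly F}} -> C}) (abs : C -> R).

Definition abs_dense (S : set C) (x : C) : Prop :=
  forall e : R, 0 < e -> exists2 y, S y & abs (x - y) < e.

(* When C is complete, the closure of K in C is a completion of K. *)
Definition Kinfty : set C := abs_dense (range iota).

Definition Kinfty_bar : set C :=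
  [set x | exists p : {poly C},
     [/\ p != 0, (forall i, Kinfty p`_i) & root p x]].

Definition abs_complete : Prop :=
  forall u : nat -> C,
    (forall e : R, 0 < e -> exists N, forall m n,
       (N <= m)%N -> (N <= n)%N -> abs (u m - u n) < e) ->
    exists l, forall e : R, 0 < e -> exists N, forall n,
      (N <= n)%N -> abs (u n - l) < e.

End ValuedExtension.

(* A completion of an algebraic closure of K_oo, presented internally:
   a complete non-archimedean field containing K with its absolute value at
   infinity (|theta| = q), in which the elements algebraic over the closure
   K_oo of K form an algebraically closed field that is dense. Such a field is
   unique up to isometric isomorphism. MathComp's normed structures assume
   `|x *+ n| = `|x| *+ n, which is impossible in characteristic p, so the
   absolute value is carried as a plain function. *)
Record Cinfty (R : realType) (F : finFieldType) := {
  Cinfty_field :> fieldType;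
  Cinfty_emb : {rmorphism {fraction {poly F}} -> Cinfty_field};
  Cinfty_abs : Cinfty_field -> R;
  Cinfty_abs_ge0 : forall x, 0 <= Cinfty_abs x;
  Cinfty_abs_eq0 : forall x, (Cinfty_abs x == 0) = (x == 0);
  Cinfty_absM : forall x y, Cinfty_abs (x * y) = Cinfty_abs x * Cinfty_abs y;
  Cinfty_absD : forall x y,
    Cinfty_abs (x + y) <= Num.max (Cinfty_abs x) (Cinfty_abs y);
  Cinfty_abs_poly : forall f : {poly F}, f != 0 ->
    Cinfty_abs (Cinfty_emb (@FracField.tofrac {poly F} f))
      = #|F|%:R ^+ (size f).-1;
  Cinfty_complete : abs_complete Cinfty_abs;
  Cinfty_closed : forall p : {poly Cinfty_field},
    (forall i, Kinfty_bar Cinfty_emb Cinfty_abs p`_i) -> size p != 1%N ->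
    exists2 x, Kinfty_bar Cinfty_emb Cinfty_abs x & root p x;
  Cinfty_dense :
    forall x, abs_dense Cinfty_abs (Kinfty_bar Cinfty_emb Cinfty_abs) x
}.

Section Sums.

Variables (R : realType) (F : finFieldType) (C : Cinfty R F) (I : choiceType).

Definition fset_lim (g : {fset I} -> C) (l : C) : Prop :=
  forall e : R, 0 < e -> exists J0 : {fset I}, forall J : {fset I},
    (J0 `<=` J)%fset -> Cinfty_abs (g J - l) < e.

Definition has_sum (D : set I) (f : I -> C) : C -> Prop :=
  fset_lim (fun J => \sum_(i <- J | i \in D) f i).

Definition has_prod (D : set I) (f : I -> C) : C -> Prop :=
  fset_lim (fun J => \prod_(i <- J | i \in D) f i).

(* Values of an unordered infinite sum and product over D; the default value
   only occurs in the absence of convergence. *)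
Definition infsum (D : set I) (f : I -> C) : C := xget 0 (has_sum D f).

Definition infprod (D : set I) (f : I -> C) : C := xget 0 (has_prod D f).

End Sums.

Section Order.

Variables (F : finFieldType) (r : nat).
Implicit Types f g : 'rV[{poly F}]_r.

(* On Omega^r the value <f, z> determines f, and the order on these values is
   defined through f alone. *)
Definition vpos f : bool :=
  [exists i : 'I_r,
     [forall j : 'I_r, (j < i)%N ==> (f ord0 j == 0)] && (f ord0 i \is monic)].

Definition vgt f g : bool :=
  [&& vpos f, vpos g &
   [exists i : 'I_r,
      [forall j : 'I_r, (j < i)%N ==> (f ord0 j == 0) && (g ord0 j == 0)] &&
      ([&& f ord0 i \is monic, g ord0 i \is monic
         & (size (g ord0 i) < size (f ord0 i))%N]
       || (f ord0 i \is monic) && (g ord0 i == 0))]].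

End Order.

Section Eisenstein.

Variables (R : realType) (F : finFieldType) (C : Cinfty R F).

Definition Aemb (f : {poly F}) : C :=
  Cinfty_emb C (@FracField.tofrac {poly F} f).

Definition pairing (r : nat) (f : 'rV[{poly F}]_r) (z : 'rV[C]_r) : C :=
  \sum_(i < r) Aemb (f ord0 i) * z ord0 i.

(* Rank r.+1: the last coordinate is ord_max. *)
Definition Omega (r : nat) : set 'rV[C]_r.+1 :=
  [set z | (forall c : 'rV[C]_r.+1,
              (forall i, Kinfty (Cinfty_emb C) (@Cinfty_abs _ _ C) (c ord0 i)) ->
              \sum_(i < r.+1) c ord0 i * z ord0 i = 0 -> c = 0)
           /\ z 0 ord_max = 1].

Definition Eisenstein (r : nat) (a : seq nat) (z : 'rV[C]_r) : C :=
  if a is [::] then 1 else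
  infsum
    [set f : seq 'rV[{poly F}]_r |
       [/\ size f = size a, sorted (@vgt F r) f & all (@vpos F r) f]]
    (fun f => (\prod_(j < size a) pairing f`_j z ^+ nth 0%N a j)^-1).

Definition lattice (s : nat) (w : 'rV[C]_s) : set C :=
  range (fun f : 'rV[{poly F}]_s => pairing f w).

Definition exp_lattice (s : nat) (w : 'rV[C]_s) (x : C) : C :=
  x * infprod [set l | lattice w l /\ l != 0] (fun l => 1 - x / l).

Definition t_lattice (s : nat) (w : 'rV[C]_s) (x : C) : C :=
  (exp_lattice w x)^-1.

Definition is_Goss (s : nat) (w : 'rV[C]_s) (k : nat) (G : {poly C}) : Prop :=
  forall x, ~ lattice w x ->
    has_sum (lattice w) (fun l => ((x + l) ^+ k)^-1) G.[t_lattice w x].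

Definition Goss (s : nat) (w : 'rV[C]_s) (k : nat) : {poly C} :=
  xget 0 (is_Goss w k).

Definition monic_chain (i : nat) : set (seq {poly F}) :=
  [set f | [/\ size f = i,
               all (fun g : {poly F} => g \is monic) f &
               sorted (fun g h : {poly F} => (size h < size g)%N) f]].

End Eisenstein.

(* Main.v *)
(* The vectors f in A^r with f > 0 have a first coordinate which is 0 or monic,
   and in a chain f_1 > ... > f_m those with a monic first coordinate come
   first, with strictly decreasing degrees. Summing over a first vector with
   first coordinate h in A_+ yields the lattice sum of 1/(h z_1 + l)^k over
   Lambda_z', which is G_k(t(h z_1)), times a chain sum bounded by deg h;
   induction on the index gives the formula. All sums are rearranged freely,
   since over a complete non-archimedean field a family is summable as soon as
   it tends to 0, and A^r is discrete in C_oo.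

   Goss polynomials are obtained from finite subgroups V exhausting the lattice:
   for P = X prod (1 - X/l) the polynomial P(x) - P has the simple roots x + l,
   and P' = 1, which gives
     P(x) S_k(x) = [k = 1] + sum_(0 < j < k) P_j S_(k-j)(x)
   for S_k(x) = sum_l 1/(x + l)^k. This recurrence passes to the limit. *)

Require Import Defs.
From mathcomp Require Import all_boot all_order all_algebra.
From mathcomp Require Import finmap.
From mathcomp Require Import boolp classical_sets reals.

Set Implicit Arguments.
Unset Strict Implicit.
Unset Printing Implicit Defensive.

Import Order.TTheory GRing.Theory Num.Theory.

Local Open Scope ring_scope.

(** * Summation over a complete non-archimedean field *)

Section AbsoluteValue.

Variables (R : realType) (F : finFieldType) (C : Cinfty R F).
Implicit Types x y : C.

Local Notation abs := (@Cinfty_abs R F C).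

Lemma abs0 : abs 0 = 0.
Proof. by apply/eqP; rewrite Cinfty_abs_eq0. Qed.

Lemma abs_gt0 x : (0 < abs x) = (x != 0).
Proof. by rewrite lt_def Cinfty_abs_ge0 andbT Cinfty_abs_eq0. Qed.

Lemma abs1 : abs 1 = 1.
Proof.
have n0 : abs 1 != 0 by rewrite Cinfty_abs_eq0 oner_neq0.
by apply: (mulfI n0); rewrite -Cinfty_absM !mulr1.
Qed.

Lemma absN x : abs (- x) = abs x.
Proof.
suff h : abs (-1) = 1 by rewrite -mulN1r Cinfty_absM h mul1r.
apply/eqP; rewrite -(@eqrXn2 _ 2%N) ?Cinfty_abs_ge0 ?ler01 //.
by rewrite expr1n expr2 -Cinfty_absM mulrNN mulr1 abs1.
Qed.

Lemma absB x y : abs (x - y) = abs (y - x).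
Proof. by rewrite -absN opprB. Qed.

Lemma absX x k : abs (x ^+ k) = abs x ^+ k.
Proof.
elim: k => [|k IH]; first by rewrite !expr0 abs1.
by rewrite !exprS Cinfty_absM IH.
Qed.

Lemma absV x : abs x^-1 = (abs x)^-1.
Proof.
have [->|x0] := eqVneq x 0; first by rewrite invr0 abs0 invr0.
have n0 : abs x != 0 by rewrite Cinfty_abs_eq0.
by apply: (mulfI n0); rewrite -Cinfty_absM !divff // abs1.
Qed.

Lemma absD_lt x y e : abs x < e -> abs y < e -> abs (x + y) < e.
Proof.
by move=> hx hy; apply: le_lt_trans (Cinfty_absD _ _) _; rewrite gt_max hx.
Qed.

Lemma absD_le x y e : abs x <= e -> abs y <= e -> abs (x + y) <= e.
Proof.
by move=> hx hy; apply: le_trans (Cinfty_absD _ _) _; rewrite ge_max hx.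
Qed.

Lemma abs_sub_lt x y z e : abs (x - y) < e -> abs (y - z) < e -> abs (x - z) < e.
Proof. by move=> h1 h2; rewrite -(subrK y x) -addrA absD_lt. Qed.

Lemma abs_sum_lt (I : Type) (s : seq I) (P : pred I) (f : I -> C) e : 0 < e ->
  (forall i, P i -> abs (f i) < e) -> abs (\sum_(i <- s | P i) f i) < e.
Proof.
move=> e0 h; elim/big_rec: _ => [|i x /h hi hx]; first by rewrite abs0.
exact: absD_lt.
Qed.

Lemma abs_small_eq0 x : (forall e, 0 < e -> abs x < e) -> x = 0.
Proof.
move=> h; apply/eqP; apply: contraT => x0.
by have := h (abs x); rewrite abs_gt0 x0 ltxx => /(_ isT).
Qed.

Lemma invS_lt (e : R) : 0 < e -> exists N, forall n, (N <= n)%N -> n.+1%:R^-1 < e.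
Proof.
move=> e0; exists (Num.bound e^-1) => n hn.
have hb := archi_boundP (ltW (_ : 0 < e^-1)).
rewrite invf_plt ?posrE ?ltr0n //; apply: lt_trans (hb _) _; first by rewrite invr_gt0.
by rewrite ltr_nat ltnS.
Qed.

End AbsoluteValue.

(** * Limits of sequences and of nets indexed by finite sets *)

Section Limits.

Variables (R : realType) (F : finFieldType) (C : Cinfty R F).

Local Notation abs := (@Cinfty_abs R F C).

Definition seq_lim (u : nat -> C) (l : C) : Prop :=
  forall e : R, 0 < e -> exists N, forall n, (N <= n)%N -> abs (u n - l) < e.

Lemma seq_lim_uniq u l l' : seq_lim u l -> seq_lim u l' -> l = l'.
Proof.
move=> h h'; apply/eqP; rewrite -subr_eq0; apply/eqP/abs_small_eq0 => e e0.
have [N hN] := h e e0; have [N' hN'] := h' e e0.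
apply: (@abs_sub_lt _ _ _ _ (u (maxn N N'))); last by rewrite hN' ?leq_maxr.
by rewrite absB hN ?leq_maxl.
Qed.

Lemma seq_lim_cst c : seq_lim (fun=> c) c.
Proof. by move=> e e0; exists 0%N => n _; rewrite subrr abs0. Qed.

Lemma eq_seq_lim u v l : u =1 v -> seq_lim u l -> seq_lim v l.
Proof. by move=> /funext ->. Qed.

Lemma seq_limD u v a b :
  seq_lim u a -> seq_lim v b -> seq_lim (fun n => u n + v n) (a + b).
Proof.
move=> hu hv e e0; have [N hN] := hu e e0; have [M hM] := hv e e0.
exists (maxn N M) => n; rewrite geq_max => /andP[/hN h1 /hM h2].
by rewrite opprD addrACA absD_lt.
Qed.

Lemma seq_limM u v a b :
  seq_lim u a -> seq_lim v b -> seq_lim (fun n => u n * v n) (a * b).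
Proof.
(* [B] bounds [abs b], and also [abs (u n)] as soon as [abs (u n - a) < 1], by the ultrametric
   inequality. *)
move=> hu hv e e0; pose B := Num.max 1 (Num.max (abs a) (abs b)).
have B0 : 0 < B by rewrite lt_max ltr01.
have hB x : abs x <= B -> forall y, abs y < Num.min 1 (e / B) -> abs (x * y) < e.
  move=> hx y hy; rewrite Cinfty_absM.
  apply: le_lt_trans (ler_wpM2r (Cinfty_abs_ge0 _) hx) _.
  by rewrite mulrC -ltr_pdivlMr //; apply: lt_le_trans hy _; rewrite ge_min lexx orbT.
have m0 : 0 < Num.min 1 (e / B) by rewrite lt_min ltr01 divr_gt0.
have [N hN] := hu _ m0; have [M hM] := hv _ m0.
exists (maxn N M) => n; rewrite geq_max => /andP[/hN h1 /hM h2].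
have -> : u n * v n - a * b = u n * (v n - b) + b * (u n - a).
  by rewrite !mulrBr (mulrC b (u n)) (mulrC b a) addrA subrK.
apply: absD_lt; apply: hB => //; last by rewrite !le_max lexx !orbT.
rewrite -(subrK a (u n)); apply: absD_le; last by rewrite !le_max lexx !orbT.
apply: ltW; apply: lt_le_trans h1 _.
by rewrite ge_min le_max lexx.
Qed.

Lemma seq_limN u a : seq_lim u a -> seq_lim (fun n => - u n) (- a).
Proof.
move=> hu; have := seq_limM (seq_lim_cst (-1)) hu; rewrite mulN1r.
by apply: eq_seq_lim => n; rewrite mulN1r.
Qed.

Lemma seq_lim_sum (I : Type) (s : seq I) (u : I -> nat -> C) (l : I -> C) :
  (forall i, seq_lim (u i) (l i)) ->
  seq_lim (fun n => \sum_(i <- s) u i n) (\sum_(i <- s) l i).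
Proof.
move=> h; elim: s => [|i s IH].
  by rewrite big_nil; apply: eq_seq_lim (seq_lim_cst 0) => n; rewrite big_nil.
rewrite big_cons; apply: eq_seq_lim (seq_limD (h i) IH) => n.
by rewrite big_cons.
Qed.

Section Nets.

Variable (I : choiceType).
Implicit Types (g : {fset I} -> C) (J : {fset I}).

Lemma fset_lim_uniq g l l' : fset_lim g l -> fset_lim g l' -> l = l'.
Proof.
move=> h h'; apply/eqP; rewrite -subr_eq0; apply/eqP/abs_small_eq0 => e e0.
have [J hJ] := h e e0; have [J' hJ'] := h' e e0.
apply: (@abs_sub_lt _ _ _ _ (g (J `|` J')%fset)).
  by rewrite absB hJ ?fsubsetUl.
by rewrite hJ' ?fsubsetUr.
Qed.

(** The sets that work for the bounds [1/(n+1)] are accumulated into an increasing sequence [K].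
    Along it [g] is Cauchy, so completeness gives a limit, and [g] stays close to [g (K n)] on all
    larger sets. *)
Lemma fset_lim_exists g :
  (forall e : R, 0 < e -> exists J0, forall J, (J0 `<=` J)%fset ->
     abs (g J - g J0) < e) ->
  exists l, fset_lim g l.
Proof.
move=> h; have inv0 n : 0 < n.+1%:R^-1 :> R by rewrite invr_gt0 ltr0n.
have [Js hJs] := choice (fun n => h _ (inv0 n)).
pose K n := (\bigcup_(i <- iota 0 n.+1) Js i)%fset.
have JK n m : (n <= m)%N -> (Js n `<=` K m)%fset.
  by move=> nm; rewrite /K bigfcup_sup // mem_iota.
have close e : 0 < e -> exists N, forall J n, (N <= n)%N -> (K n `<=` J)%fset ->
    abs (g J - g (K n)) < e.
  move=> e0; have [N hN] := invS_lt e0; exists N => J n Nn KJ.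
  apply: (@abs_sub_lt _ _ _ _ (g (Js N))).
    apply: lt_trans (hN N _) => //; apply: hJs.
    exact: fsubset_trans (JK _ _ Nn) KJ.
  by rewrite absB; apply: lt_trans (hN N _) => //; apply/hJs/JK.
have /(@Cinfty_complete _ _ C)[l hl] : forall e : R, 0 < e -> exists N, forall m n,
    (N <= m)%N -> (N <= n)%N -> abs ((g \o K) m - (g \o K) n) < e.
  move=> e e0; have [N hN] := close e e0; exists N => m n Nm Nn /=.
  have KU p : (N <= p)%N -> (K N `<=` K p)%fset.
    move=> Np; apply/bigfcupsP => i; rewrite mem_iota /= add0n ltnS => iN _.
    by apply: JK; apply: leq_trans iN Np.
  apply: (@abs_sub_lt _ _ _ _ (g (K N))); first by rewrite hN ?KU.
  by rewrite absB hN ?KU.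
exists l => e e0; have [N hN] := close e e0; have [M hM] := hl e e0.
exists (K (maxn N M)) => J KJ.
apply: (@abs_sub_lt _ _ _ _ (g (K (maxn N M)))).
  by apply: hN; rewrite ?leq_maxl.
by apply: hM; rewrite leq_maxr.
Qed.

(** The sets [J n] may miss elements of [J0]: a sum or product restricted to [D] keeps its value
    when elements outside [D] are adjoined. *)
Lemma seq_lim_fset_lim g l (J : nat -> {fset I}) :
  fset_lim g l ->
  (forall J0 : {fset I}, exists N, forall n, (N <= n)%N ->
     exists2 J', (J0 `<=` J')%fset & g J' = g (J n)) ->
  seq_lim (fun n => g (J n)) l.
Proof.
move=> gl hJ e e0; have [J0 hJ0] := gl e e0; have [N hN] := hJ J0.
by exists N => n /hN [J' /hJ0 + <-].
Qed.

End Nets.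

End Limits.

Section BigFset.

Variables (T : Type) (idx : T) (op : Monoid.com_law idx) (I : choiceType).

Lemma big_fset_split (A B : {fset I}) (P : pred I) (f : I -> T) :
  (A `<=` B)%fset ->
  \big[op/idx]_(i <- B | P i) f i =
  op (\big[op/idx]_(i <- A | P i) f i)
     (\big[op/idx]_(i <- B | P i && (i \notin A)) f i).
Proof.
move=> AB; rewrite (bigID (mem A)) /=; congr (op _ _).
rewrite [LHS]big_mkcond -(big_fset_incl _ AB) /=.
  by rewrite [RHS]big_mkcond; apply: eq_big_seq => i ->; rewrite andbT.
by move=> i _ /negbTE ->; rewrite andbF.
Qed.

Lemma big_fset_pred1 (A : {fset I}) (k : I) (f : I -> T) :
  \big[op/idx]_(i <- A | i == k) f i = if k \in A then f k else idx.
Proof.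
case: ifPn => kA.
  by rewrite -big_filter filter_pred1_uniq ?fset_uniq // big_seq1.
rewrite big_seq_cond big_pred0 // => i; apply/negP => /andP[iA /eqP ik].
by rewrite -ik iA in kA.
Qed.

End BigFset.

(** * Unordered sums and products: existence, linearity, regrouping *)

Section Summation.

Variables (R : realType) (F : finFieldType) (C : Cinfty R F).

Local Notation abs := (@Cinfty_abs R F C).

(* Over a complete non-archimedean field this is equivalent to summability. *)
Definition vanish (I : choiceType) (D : set I) (f : I -> C) : Prop :=
  forall e : R, 0 < e -> exists J : {fset I}, forall i,
    D i -> i \notin J -> abs (f i) < e.

Section OneIndex.

Variable I : choiceType.
Implicit Types (D : set I) (f : I -> C) (J : {fset I}).

Lemma vanishS D D' f : (D `<=` D')%classic -> vanish D' f -> vanish D f.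
Proof. by move=> DD h e /h[J hJ]; exists J => i /DD; apply: hJ. Qed.

Lemma eq_vanish D f g : (forall i, D i -> f i = g i) -> vanish D f -> vanish D g.
Proof. by move=> fg h e /h[J hJ]; exists J => i Di; rewrite -fg //; apply: hJ. Qed.

Lemma vanish_bound D f : vanish D f -> exists2 B, 0 < B & forall i, D i -> abs (f i) <= B.
Proof.
move=> /(_ 1 ltr01)[J hJ]; exists (\sum_(i <- J) abs (f i) + 1).
  by rewrite ltr_wpDl // sumr_ge0 // => i _; rewrite Cinfty_abs_ge0.
move=> i Di; have [iJ|/(hJ _ Di)/ltW h] := boolP (i \in J).
  rewrite (big_rem i) //= -addrA ler_wpDr // addr_ge0 // sumr_ge0 // => j _.
  exact: Cinfty_abs_ge0.
by apply: le_trans h _; rewrite ler_wpDl // sumr_ge0 // => j _; rewrite Cinfty_abs_ge0.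
Qed.

(** By the ultrametric inequality a finite sum of terms outside [J0] is as small as its largest
    term, so the partial sums are Cauchy. *)
Lemma has_sum_exists D f : vanish D f -> exists l, has_sum D f l.
Proof.
move=> h; apply: fset_lim_exists => e e0; have [J0 hJ0] := h e e0.
exists J0 => J J0J; rewrite (big_fset_split _ _ _ J0J) addrAC subrr add0r.
by apply: abs_sum_lt => // i /andP[/set_mem Di iJ]; apply: hJ0.
Qed.

(** Adjoining one index [i] to [J] changes the partial sum by [f i], while both partial sums are
    within [e] of the limit. *)
Lemma has_sum_vanish D f l : has_sum D f l -> vanish D f.
Proof.
move=> h e e0; have [J hJ] := h e e0; exists J => i Di iJ.
have := abs_sub_lt (hJ (i |` J)%fset (fsubsetUr _ _))
  (eq_ind_r (fun t => t < e) (hJ J (fsubset_refl _)) (absB _ _)).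
rewrite (big_fset_split _ _ _ (fsubsetUr _ _)) addrAC subrr add0r.
rewrite (eq_bigl (fun j => (j \in D) && (j \notin J))) //.
rewrite big_mkcond big_fsetU1 //= iJ mem_set //= big1_seq ?addr0 //.
by move=> j /andP[_ jJ]; rewrite jJ andbF.
Qed.

Lemma has_sum_infsum D f l : has_sum D f l -> infsum D f = l.
Proof.
move=> h; apply: fset_lim_uniq (h).
by apply: (@xgetPex _ _ (has_sum D f)); exists l.
Qed.

Lemma infsumP D f : vanish D f -> has_sum D f (infsum D f).
Proof. by move=> /has_sum_exists[l h]; rewrite (has_sum_infsum h). Qed.

Lemma eq_has_sum D f g l :
  (forall i, D i -> f i = g i) -> has_sum D f l -> has_sum D g l.
Proof.
move=> fg h e /h[J hJ]; exists J => J' /hJ.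
by rewrite (eq_bigr g) // => i /set_mem; apply: fg.
Qed.

Lemma has_sum1 (i : I) f : has_sum [set i]%classic f (f i).
Proof.
move=> e e0; exists [fset i]%fset => J; rewrite fsub1set => iJ.
rewrite (eq_bigl (fun j => j == i)) => [|j]; last first.
  by apply/idP/eqP => [/set_mem //|->]; apply: mem_set.
by rewrite big_fset_pred1 iJ subrr abs0.
Qed.

Lemma has_sumZ D f l c : has_sum D f l -> has_sum D (fun i => c * f i) (c * l).
Proof.
(* The summand 1 keeps the divisor positive when [c] is 0. *)
move=> h e e0; have c0 : 0 < abs c + 1 by rewrite ltr_wpDl ?Cinfty_abs_ge0.
have [J hJ] := h (e / (abs c + 1)) (divr_gt0 e0 c0); exists J => J' /hJ.
rewrite -mulr_sumr -mulrBr Cinfty_absM ltr_pdivlMr // mulrC.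
by apply: le_lt_trans; rewrite ler_wpM2r ?Cinfty_abs_ge0 // lerDl.
Qed.

Lemma has_sumD D f g l m :
  has_sum D f l -> has_sum D g m -> has_sum D (fun i => f i + g i) (l + m).
Proof.
move=> hf hg e e0; have [J hJ] := hf e e0; have [K hK] := hg e e0.
exists (J `|` K)%fset => L; rewrite fsubUset => /andP[/hJ h1 /hK h2].
by rewrite big_split /= opprD addrACA absD_lt.
Qed.

Lemma has_sum_sum D (T : Type) (s : seq T) (f : T -> I -> C) (l : T -> C) :
  (forall t, has_sum D (f t) (l t)) ->
  has_sum D (fun i => \sum_(t <- s) f t i) (\sum_(t <- s) l t).
Proof.
move=> h; elim: s => [|t s IH].
  move=> e e0; exists fset0 => J _; rewrite big1 ?big_nil ?subrr ?abs0 // => i _.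
  by rewrite big_nil.
rewrite big_cons; apply: eq_has_sum (has_sumD (h t) IH) => i _.
by rewrite big_cons.
Qed.

Lemma has_sumU D D' f l l' : (forall i, D i -> ~ D' i) ->
  has_sum D f l -> has_sum D' f l' -> has_sum (D `|` D')%classic f (l + l').
Proof.
move=> dis hf hg e e0; have [J hJ] := hf e e0; have [K hK] := hg e e0.
exists (J `|` K)%fset => L; rewrite fsubUset => /andP[/hJ h1 /hK h2].
rewrite (bigID (mem D)) /= opprD.
rewrite (eq_bigl (fun i => i \in D)) => [|i]; last first.
  by rewrite in_setU; case: (i \in D); rewrite ?andbF.
rewrite [X in _ + X + _](eq_bigl (fun i => i \in D')) => [|i].
  by rewrite addrACA absD_lt.
rewrite in_setU; case: (boolP (i \in D)) => /=; last by rewrite andbT.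
by move=> /set_mem /dis h; apply/esym/negP => /set_mem.
Qed.

(** Outside [J1] every factor has absolute value at most 1, so [B] bounds all partial products over
    sets containing [J1]. Enlarging such a set further multiplies by factors close to 1, whose
    product is again close to 1. *)
Lemma has_prod_exists D f : vanish D f -> exists l, has_prod D (fun i => 1 + f i) l.
Proof.
move=> h; have [J1 hJ1] := h 1 ltr01.
pose m i := if i \in D then Num.max 1 (abs (f i)) else 1.
have m1 i : 1 <= m i by rewrite /m; case: ifP => // _; rewrite le_max lexx.
pose B := \prod_(i <- J1) m i.
have B1 : 1 <= B by rewrite /B; elim/big_rec: _ => // i x _; apply: mulr_ege1.
have bound J : (J1 `<=` J)%fset -> abs (\prod_(i <- J | i \in D) (1 + f i)) <= B.
  move=> J1J; apply: (@le_trans _ _ (\prod_(i <- J) m i)).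
    rewrite big_mkcond; elim/big_ind2: _ => [|x x' y y' hx hy|i _].
    - by rewrite abs1.
    - by rewrite Cinfty_absM ler_pM ?Cinfty_abs_ge0.
    - rewrite /m; case: ifP => _; last by rewrite abs1.
      by rewrite -(abs1 C) Cinfty_absD.
  rewrite /B (big_fset_incl _ J1J) // => i iJ iJ1; rewrite /m; case: ifP => // iD.
  by apply/max_l/ltW/hJ1 => //; apply: set_mem.
apply: fset_lim_exists => e e0.
have e'0 : 0 < Num.min 1 (e / B) by rewrite lt_min ltr01 divr_gt0 // (lt_le_trans ltr01).
have [J2 hJ2] := h _ e'0; exists (J1 `|` J2)%fset => J J12.
rewrite (big_fset_split _ _ _ J12) -[X in _ * _ - X]mulr1 -mulrBr Cinfty_absM.
apply: le_lt_trans (ler_wpM2r (Cinfty_abs_ge0 _) (bound _ (fsubsetUl _ _))) _.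
rewrite mulrC -ltr_pdivlMr ?(lt_le_trans ltr01) //.
suff : abs (\prod_(i <- J | (i \in D) && (i \notin (J1 `|` J2)%fset)) (1 + f i) - 1)
   < Num.min 1 (e / B) by move=> h1; apply: lt_le_trans h1 _; rewrite ge_min lexx orbT.
elim/big_rec: _ => [|i x /andP[/set_mem iD iJ] hx]; first by rewrite subrr abs0.
have -> : (1 + f i) * x - 1 = (x - 1) + (f i * (x - 1) + f i).
  by rewrite mulrDl mul1r mulrBr mulr1 subrK addrAC.
have hi : abs (f i) < Num.min 1 (e / B).
  by apply: hJ2 => //; apply: contra iJ; rewrite in_fsetU => ->; rewrite orbT.
do 2 apply: absD_lt => //; rewrite Cinfty_absM; apply: le_lt_trans hx.
rewrite ler_piMl ?Cinfty_abs_ge0 //; apply: ltW; apply: lt_le_trans hi _.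
by rewrite ge_min lexx.
Qed.

End OneIndex.

Section TwoIndices.

Variables I K : choiceType.

(** Summation by fibres. For a finite [L] containing the image of [J0], take a finite set [J]
    containing [J0] and a good approximation of the fibre over each [k] in [L]. The part of [J] over
    [L] has a sum close both to [l] and to the sum of [g] over [L], since ultrametric errors do not
    accumulate. *)
Lemma has_sum_fibers (p : I -> K) (D : set I) (E : set K) (f : I -> C)
    (g : K -> C) (l : C) :
  has_sum D f l -> (forall i, D i -> E (p i)) ->
  (forall k, E k -> has_sum [set i | D i /\ p i = k]%classic f (g k)) ->
  has_sum E g l.
Proof.
move=> hf DE hg e e0; have [J0 hJ0] := hf e e0.
have /choice[Js hJs] : forall k, exists J : {fset I}, forall J' : {fset I}, E k ->
    (J `<=` J')%fset -> abs (\sum_(i <- J' | (i \in D) && (p i == k)) f i - g k) < e.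
  move=> k; have [Ek|nEk] := pselect (E k); last by exists fset0.
  have [J hJ] := hg k Ek e e0; exists J => J' _ /hJ.
  congr (abs (_ - _) < e); apply: eq_bigl => i.
  by apply/idP/andP => [/set_mem[Di /eqP]|[/set_mem Di /eqP pi]];
    rewrite ?mem_set.
exists (p @` J0)%fset => L J0L.
pose J := (J0 `|` \bigcup_(k <- L) Js k)%fset.
have J0J : (J0 `<=` [fset i in J | p i \in L])%fset.
  apply/fsubsetP => i iJ0; rewrite !inE /= iJ0 /=.
  by apply: (fsubsetP J0L); rewrite in_imfset.
have := hJ0 _ J0J; rewrite absB => h1; rewrite absB.
set s := \sum_(i <- _ | _) _ in h1.
suff h2 : abs (s - \sum_(k <- L | k \in E) g k) < e.
  exact: abs_sub_lt h1 h2.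
have -> : s = \sum_(k <- L | k \in E) \sum_(i <- J | (i \in D) && (p i == k)) f i.
  rewrite (exchange_big_dep (fun i => i \in D)) /=; last by move=> k i _ /andP[].
  rewrite /s [LHS]big_mkcond /= big_fset /= [LHS]big_mkcond [RHS]big_mkcond /=.
  apply: eq_bigr => i _.
  case: (boolP (i \in D)) => [iD|_]; last by rewrite if_same.
  rewrite (eq_bigl (fun k => k == p i)) ?big_fset_pred1 // => k /=.
  rewrite eq_sym; case: eqVneq => [->|]; last by rewrite andbF.
  by rewrite andbT; apply/mem_set/DE/set_mem.
rewrite -sumrB big_seq_cond; apply: abs_sum_lt => // k /andP[kL /set_mem Ek].
apply: hJs => //; apply: fsubset_trans (fsubsetUr _ _).
by apply: bigfcup_sup.
Qed.

(** Reindexing along an injection: each fibre over the image is a single index. *)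
Lemma has_sum_image (h : I -> K) (D : set I) (f : K -> C) (l : C) :
  (forall i j, D i -> D j -> h i = h j -> i = j) ->
  has_sum D (f \o h) l -> has_sum [set h i | i in D]%classic f l.
Proof.
move=> inj hs; apply: (has_sum_fibers (p := h) hs) => [i Di|k [i Di <-]].
  by exists i.
apply: eq_has_sum (_ : has_sum _ _ ((f \o h) i)) => [j [_ /= ->] //|].
rewrite (_ : mkset _ = [set i]%classic); first exact: has_sum1.
apply/seteqP; split=> j /=; last by move=> ->.
by case=> Dj /inj; apply.
Qed.

End TwoIndices.

End Summation.

(** * Goss polynomials *)

Section FiniteSubgroup.

Variable L : fieldType.

Lemma deriv_prod_XsubC (s : seq L) :
  (\prod_(y <- s) ('X - y%:P))^`() =
  \sum_(y <- s) (\prod_(u <- s) ('X - u%:P)) %/ ('X - y%:P).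
Proof.
elim: s => [|a s IH]; first by rewrite !big_nil derivC.
rewrite !big_cons derivM derivXsubC mul1r IH mulKp ?polyXsubC_eq0 //.
congr (_ + _); rewrite mulr_sumr; apply: eq_big_seq => y ys.
by rewrite divp_mulA // dvdp_XsubCl root_prod_XsubC.
Qed.

(** The finite version of [exp_lattice], normalised by its linear coefficient 1 so that its values
    converge when [V] grows to the lattice. *)
Definition subgroup_poly (V : seq L) : {poly L} :=
  'X * \prod_(l <- V | l != 0) (1 - l^-1 *: 'X).

Lemma horner_subgroup_poly V x :
  (subgroup_poly V).[x] = x * \prod_(l <- V | l != 0) (1 - x / l).
Proof.
rewrite hornerM hornerX horner_prod; congr (_ * _); apply: eq_bigr => l _.
by rewrite !hornerE mulrC.
Qed.

Lemma coef0_subgroup_poly V : (subgroup_poly V)`_0 = 0.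
Proof. by rewrite -horner_coef0 hornerM hornerX mul0r. Qed.

Variable V : seq L.
Hypotheses (uV : uniq V) (V0 : 0 \in V).
Hypothesis VB : forall a b, a \in V -> b \in V -> a - b \in V.

Let P := subgroup_poly V.
Let c := \prod_(l <- V | l != 0) (- l^-1).

Lemma subgroup_polyE : P = c *: \prod_(l <- V) ('X - l%:P).
Proof.
rewrite (bigD1_seq 0) //= subr0 scalerAr /P /subgroup_poly -scalerAr scalerAr.
congr (_ * _); rewrite -mul_polyC /c rmorph_prod -big_split /=.
apply: eq_bigr => l l0.
rewrite mul_polyC scalerBr !scaleNr opprK.
by rewrite -[l%:P]alg_polyC scalerA mulVf // scale1r addrC.
Qed.

(** Translation by [l] permutes the roots: subtracting [l] is injective and maps the finite set [V]
    into itself. *)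
Lemma subgroup_poly_period l : l \in V -> P \Po ('X + l%:P) = P.
Proof.
move=> lV; rewrite subgroup_polyE comp_polyZ rmorph_prod /=; congr (_ *: _).
have <- : \prod_(u <- [seq v - l | v <- V]) ('X - u%:P) = \prod_(u <- V) ('X - u%:P).
  apply: perm_big; apply: uniq_perm => //.
    by rewrite map_inj_uniq // => u v /addIr.
  apply/(uniq_min_size _ _ _).2; rewrite ?size_map //.
    by rewrite map_inj_uniq // => u v /addIr.
  by move=> _ /mapP[u Vu ->]; apply: VB.
rewrite big_map; apply: eq_bigr => u _.
by rewrite comp_polyB comp_polyX comp_polyC polyCB opprB addrA addrAC.
Qed.

Lemma size_subgroup_poly : size P = (size V).+1.
Proof.
rewrite subgroup_polyE size_scale ?size_prod_XsubC // /c.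
by rewrite prodf_seq_neq0; apply/allP => l _; apply/implyP => l0; rewrite oppr_eq0 invr_eq0.
Qed.

(** By periodicity the derivative takes on all of [V] its value at 0, which is 1. The derivative
    minus 1 thus has [size V] roots and a smaller degree, so it vanishes. *)
Lemma deriv_subgroup_poly : P^`() = 1.
Proof.
have d0 : P^`().[0] = 1.
  rewrite derivM derivX mul1r hornerD hornerM hornerX mul0r addr0 horner_prod.
  by rewrite big1 // => l _; rewrite !hornerE ?mulr0 ?mul0r subr0.
apply/eqP; rewrite -subr_eq0; apply: contraT => n0.
have sz : (size (P^`() - 1)%R <= size V)%N.
  apply: leq_trans (size_polyD _ _) _; rewrite geq_max size_polyN size_poly1.
  rewrite -ltnS -size_subgroup_poly lt_size_deriv -?size_poly_gt0 ?size_subgroup_poly //=.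
  by case: V V0.
move: sz; rewrite leqNgt max_poly_roots //; apply/allP => l lV.
rewrite /root hornerD hornerN hornerC subr_eq0 -d0.
have /(congr1 (horner^~ 0)) := congr1 (@deriv L) (subgroup_poly_period lV).
rewrite deriv_comp derivD derivX derivC addr0 mulr1.
by rewrite horner_comp hornerD hornerX hornerC add0r => ->.
Qed.

(** For [D = P(x) - P], the product rule makes the sum of [D / (X - y)] over the roots [y] equal to
    [D' = -1]. Expanding each [1 / (y - X)] brings in the power sums, and the coefficient of [X^m]
    is the recurrence. *)
Lemma subgroup_power_sums x m : (forall l, l \in V -> x + l != 0) ->
  let S k := \sum_(l <- V) ((x + l) ^+ k)^-1 in
  P.[x] * S m.+1 = (m == 0%N)%:R + \sum_(j < m) P`_j.+1 * S (m - j)%N.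
Proof.
move=> xV S; pose D := P.[x]%:P - P.
pose ys := [seq x + l | l <- V].
have szD : size D = (size V).+1.
  rewrite /D addrC size_polyDl ?size_polyN size_subgroup_poly //.
  by apply: leq_ltn_trans (size_polyC_leq1 _) _; rewrite ltnS; case: V V0.
have uys : uniq ys by rewrite map_inj_uniq // => u v /addrI.
have rD : all (root D) ys.
  apply/allP => _ /mapP[l lV ->]; rewrite /root /D hornerD hornerN hornerC.
  rewrite -{1}(subgroup_poly_period lV) horner_comp !hornerE.
  by rewrite subrr.
have D' : D^`() = -1 by rewrite derivB derivC deriv_subgroup_poly sub0r.
have DE : D = lead_coef D *: \prod_(y <- ys) ('X - y%:P).
  by apply: all_roots_prod_XsubC => //; rewrite ?size_map // uniq_rootsE.
have sumD : \sum_(y <- ys) D %/ ('X - y%:P) = -1.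
  rewrite -D' {2}DE derivZ deriv_prod_XsubC scaler_sumr.
  by apply: eq_bigr => y _; rewrite {1}DE divpZl.
(* [T y] truncates the geometric series of [1 / (y - X)]; its coefficients are the terms of the
   power sums. *)
pose T y : {poly L} := \poly_(i < m.+1) (y ^+ i.+1)^-1.
have TE y : y != 0 -> ('X - y%:P) * T y = (y ^+ m.+1)^-1 *: 'X^(m.+1) - 1.
  move=> y0; apply/polyP => i; rewrite mulrBl coefB coefXM coefCM !coef_poly.
  rewrite coefB coefZ coefXn coef1.
  case: i => [|i] /=; first by rewrite mulr0 expr1 mulfV.
  rewrite eqSS !ltnS subr0 [y ^+ i.+2]exprS.
  case: ltngtP => [im|im|->]; rewrite ?mulr1 ?mulr0 ?subr0 //.
  by rewrite invfM mulrA mulfV // mul1r subrr.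
have key : \sum_(y <- ys) D * T y =
    1 + \sum_(y <- ys) (y ^+ m.+1)^-1 *: (D %/ ('X - y%:P)) * 'X^(m.+1).
  rewrite -[1]opprK -sumD -sumrN -big_split /=; apply: eq_big_seq => y yys.
  have y0 : y != 0 by case/mapP: yys => l lV ->; apply: xV.
  have dvd : 'X - y%:P %| D by rewrite dvdp_XsubCl; apply: (allP rD).
  rewrite -{1}(divpK dvd) -mulrA TE // mulrBr mulr1 addrC -scalerAl -scalerAr.
  by [].
(* In degree [m] the multiples of [X^(m+1)] disappear. The constant coefficient of [D] is [P.[x]],
   because that of [P] is 0, and the others are those of [- P]. *)
have := congr1 (fun p : {poly L} => p`_m) key.
rewrite coefD coef1 -mulr_sumr coefM big_ord_recl -mulr_suml coefMXn ltnSn addr0.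
have ST k : (k <= m)%N -> (\sum_(y <- ys) T y)`_k = S k.+1.
  by move=> km; rewrite coef_sum big_map; apply: eq_bigr => l _; rewrite coef_poly ltnS km.
rewrite subn0 ST // {1}/D coefB coefC eqxx coef0_subgroup_poly subr0 => <-.
rewrite -addrA -big_split /= big1 ?addr0 // => j _.
rewrite /bump /= add1n ST ?leq_subr // subnSK // /D coefB coefC /= sub0r.
by rewrite mulNr addNr.
Qed.

End FiniteSubgroup.

(** * Linear independence over the completion and discreteness *)

Section Lattices.

Variables (R : realType) (F : finFieldType) (C : Cinfty R F).

Local Notation abs := (@Cinfty_abs R F C).
Local Notation iota := (Cinfty_emb C).

Definition linear_indep (s : nat) (z : 'I_s -> C) : Prop :=
  forall c : 'I_s -> C, (forall i, Kinfty iota abs (c i)) ->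
    \sum_(i < s) c i * z i = 0 -> forall i, c i = 0.

Lemma Kinfty_emb k : Kinfty iota abs (iota k).
Proof. by move=> e e0; exists (iota k); [exists k | rewrite subrr abs0]. Qed.

Lemma seq_lim_Kinfty (u : nat -> {fraction {poly F}}) l :
  seq_lim (iota \o u) l -> Kinfty iota abs l.
Proof.
move=> h e /h[N /(_ N (leqnn _)) hN].
by exists (iota (u N)); [exists (u N) | rewrite absB].
Qed.

Lemma linear_indep_lift (s : nat) (z : 'I_s.+1 -> C) :
  linear_indep z -> linear_indep (fun j => z (lift ord0 j)).
Proof.
move=> li c Kc cz i.
pose c' j := if unlift ord0 j is Some k then c k else 0.
have <- : c' (lift ord0 i) = c i by rewrite /c' liftK.
apply: (li c') => [j|]; rewrite /c'.
  by case: unliftP => // _; rewrite -(rmorph0 iota); apply: Kinfty_emb.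
rewrite big_ord_recl unlift_none mul0r add0r -[RHS]cz.
by apply: eq_bigr => j _; rewrite liftK.
Qed.

(* The distance from z_0 to the K-span of the other z_i is positive: otherwise,
   by the bound for these, the coefficients of a sequence in the span tending
   to -z_0 converge, to a K_oo-linear relation. *)
Lemma linear_indep_bound (s : nat) (z : 'I_s -> C) : linear_indep z ->
  exists2 c, 0 < c & forall (x : 'I_s -> {fraction {poly F}}) i,
    c * abs (iota (x i)) <= abs (\sum_(j < s) iota (x j) * z j).
Proof.
elim: s z => [|s IH] z li; first by exists 1 => // x [].
pose z' j := z (lift ord0 j).
have [c c0 hc] : exists2 c, 0 < c & forall (x : 'I_s -> {fraction {poly F}}) i,
    c * abs (iota (x i)) <= abs (\sum_(j < s) iota (x j) * z' j).
  exact/IH/linear_indep_lift.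
have [d d0 hd] : exists2 d, 0 < d & forall v : 'I_s -> {fraction {poly F}},
    d <= abs (z ord0 + \sum_(j < s) iota (v j) * z' j).
  apply: contrapT => nd.
  have /choice[v hv] : forall n, exists v : 'I_s -> {fraction {poly F}},
      abs (z ord0 + \sum_(j < s) iota (v j) * z' j) < n.+1%:R^-1.
    move=> n; apply: contrapT => nv; apply: nd; exists n.+1%:R^-1 => [|v].
      by rewrite invr_gt0 ltr0n.
    by rewrite leNgt; apply/negP => h; apply: nv; exists v.
  have /choice[l hl] : forall i, exists l, seq_lim (fun n => iota (v n i)) l.
    move=> i; apply: Cinfty_complete => e e0.
    have [N hN] := invS_lt (mulr_gt0 c0 e0); exists N => m n Nm Nn.
    rewrite -(ltr_pM2l c0) -rmorphB; apply: le_lt_trans (hc (fun i => v m i - v n i) i) _.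
    have -> : \sum_(j < s) iota (v m j - v n j) * z' j =
        (z ord0 + \sum_(j < s) iota (v m j) * z' j) -
        (z ord0 + \sum_(j < s) iota (v n j) * z' j).
      rewrite opprD addrACA subrr add0r -sumrB.
      by apply: eq_bigr => j _; rewrite rmorphB mulrBl.
    by apply: absD_lt; rewrite ?absN; apply: lt_trans (hv _) (hN _ _).
  pose c' j := if unlift ord0 j is Some k then l k else 1.
  have : c' ord0 = 0.
    apply: (li c') => [j|].
      rewrite /c'; case: unliftP => [k _|_]; first exact: seq_lim_Kinfty (hl k).
      by rewrite -(rmorph1 iota); apply: Kinfty_emb.
    rewrite big_ord_recl {1}/c' unlift_none mul1r.
    rewrite (eq_bigr (fun j => l j * z' j)) => [|j _]; last by rewrite /c' liftK.
    apply: (@seq_lim_uniq _ _ _ (fun n => z ord0 + \sum_(j < s) iota (v n j) * z' j)).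
      apply: seq_limD; first exact: seq_lim_cst.
      by apply: seq_lim_sum => j; apply: seq_limM (hl j) (seq_lim_cst _).
    move=> e e0; have [N hN] := invS_lt e0; exists N => n Nn.
    by rewrite subr0; apply: lt_trans (hv _) (hN _ _).
  by rewrite /c' unlift_none => /eqP; rewrite oner_eq0.
(* Since [v = y - x_0 z_0] and [d * abs x_0 <= abs y], the ultrametric inequality gives
   [abs v <= M * abs y], which turns the constant [c] for [z'] into [c / M]. *)
pose M := Num.max 1 (abs (z ord0) / d).
have M1 : 1 <= M by rewrite le_max lexx.
have M0 : 0 < M by apply: lt_le_trans M1.
exists (Num.min d (c / M)) => [|x i]; first by rewrite lt_min d0 divr_gt0.
rewrite big_ord_recl; set v := \sum_(j < s) _; set y := _ + v.
have hx0 : d * abs (iota (x ord0)) <= abs y.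
  have [x0|x0] := eqVneq (x ord0) 0.
    by rewrite x0 rmorph0 abs0 mulr0 Cinfty_abs_ge0.
  have i0 : iota (x ord0) != 0 by rewrite fmorph_eq0.
  (* Dividing all coefficients by [x ord0] gives a vector of the shape bounded by [hd]. *)
  have h := hd (fun j => x (lift ord0 j) / x ord0).
  rewrite mulrC; apply: le_trans (ler_wpM2l (Cinfty_abs_ge0 _) h) _.
  rewrite -Cinfty_absM mulrDr mulr_sumr le_eqVlt; apply/orP; left; apply/eqP.
  congr (abs (_ + _)); apply: eq_bigr => j _.
  by rewrite mulrA rmorphM fmorphV mulrCA divff // mulr1.
have [j ->|->] := unliftP ord0 i; last first.
  by apply: le_trans hx0; rewrite ler_wpM2r ?Cinfty_abs_ge0 // ge_min lexx.
have hv : abs v <= M * abs y.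
  have -> : v = y - iota (x ord0) * z ord0 by rewrite /y addrC addKr.
  apply: absD_le; first by rewrite ler_peMl ?Cinfty_abs_ge0.
  rewrite absN Cinfty_absM; apply: (@le_trans _ _ (abs (z ord0) / d * abs y)).
    rewrite mulrC mulrAC ler_pdivlMr // -mulrA ler_wpM2l ?Cinfty_abs_ge0 //.
    by rewrite mulrC.
  by rewrite ler_wpM2r ?Cinfty_abs_ge0 // le_max lexx orbT.
apply: (@le_trans _ _ (c / M * abs (iota (x (lift ord0 j))))).
  by rewrite ler_wpM2r ?Cinfty_abs_ge0 // ge_min lexx orbT.
rewrite mulrAC ler_pdivrMr // [abs y * M]mulrC.
exact: le_trans (hc (fun k => x (lift ord0 k)) j) hv.
Qed.

End Lattices.

(** * The exponential, the power sums and the Goss polynomials of a lattice *)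

Section Lattice.

Variables (R : realType) (F : finFieldType) (C : Cinfty R F).

Local Notation abs := (@Cinfty_abs R F C).

(** [u] tends to infinity along [D]: the form in which discreteness yields summability. *)
Definition escapes (I : choiceType) (D : set I) (u : I -> C) : Prop :=
  forall B : R, exists J : {fset I}, forall i, D i -> abs (u i) <= B -> i \in J.

Lemma escapes_vanish (I : choiceType) (D : set I) (u : I -> C) x k :
  escapes D u -> (0 < k)%N -> vanish D (fun i => ((x + u i) ^+ k)^-1).
Proof.
(* If the inverse power is at least [e], then [abs (x + u i)] is at most 1, or else at most its
   [k]-th power and so at most [e^-1]. The maximum with [abs x] passes from [x + u i] to [u i]. *)
move=> h k0 e e0; have [J hJ] := h (Num.max (Num.max 1 e^-1) (abs x)).
exists J => i Di; apply: contraR; rewrite -leNgt => he; apply: hJ => //.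
rewrite -(addKr x (u i)); apply: absD_le; first by rewrite absN le_max lexx orbT.
rewrite le_max; apply/orP; left; rewrite le_max.
have [//|/ltW h1] := leP (abs (x + u i)) 1.
apply/orP; right; apply: (@le_trans _ _ (abs (x + u i) ^+ k)).
  by rewrite ler_eXnr.
rewrite absV absX in he.
have p0 : 0 < (abs (x + u i) ^+ k)^-1 by apply: lt_le_trans e0 he.
by rewrite -[leLHS]invrK lef_pV2 ?posrE.
Qed.


Section Exhaustion.

Variables (T : Type) (idx : C) (op : Monoid.com_law idx) (I : choiceType).

Lemma seq_lim_exhaust (D : set I) (f : I -> C) l (V : nat -> {fset I}) :
  (forall J : {fset I}, exists N, forall n, (N <= n)%N ->
     forall i, i \in J -> D i -> i \in V n) ->
  fset_lim (fun J => \big[op/idx]_(i <- J | i \in D) f i) l ->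
  seq_lim (fun n => \big[op/idx]_(i <- V n | i \in D) f i) l.
Proof.
move=> hV /seq_lim_fset_lim; apply=> J; have [N hN] := hV J.
exists N => n Nn; exists (V n `|` J)%fset; first exact: fsubsetUr.
rewrite (big_fset_split _ _ _ (fsubsetUl _ _)) [X in op _ X]big_seq_cond.
rewrite [X in op _ X]big_pred0 ?Monoid.mulm1 // => i; apply/negP.
rewrite in_fsetU => /and3P[/orP[->//|iJ] /set_mem Di] /negP; apply.
exact: hN.
Qed.

End Exhaustion.

Variables (s : nat) (w : 'rV[C]_s).

Lemma AembB f g : Aemb C (f - g) = Aemb C f - Aemb C g.
Proof. by rewrite /Aemb !rmorphB. Qed.

Lemma pairingB f g : pairing (f - g) w = pairing f w - pairing g w.
Proof.
rewrite /pairing -sumrB; apply: eq_bigr => i _.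
by rewrite !mxE AembB mulrBl.
Qed.

Lemma pairing0 : pairing 0 w = 0.
Proof. by rewrite -(subrr 0) pairingB subrr. Qed.

Lemma pairingN f : pairing (- f) w = - pairing f w.
Proof. by rewrite -[- f]sub0r pairingB pairing0 sub0r. Qed.

(** A crude bound, from [n < #|F| ^ n] with [n] the degree. It turns bounds on absolute values into
    degree bounds. *)
Lemma size_le_abs (f : {poly F}) : (size f)%:R <= abs (Aemb C f).
Proof.
have [->|f0] := eqVneq f 0; first by rewrite size_poly0 Cinfty_abs_ge0.
rewrite /Aemb Cinfty_abs_poly // -natrX ler_nat.
rewrite -[X in (X <= _)%N]prednK ?size_poly_gt0 // ltn_expl //.
exact: card_finNzRing_gt1.
Qed.

(** The coefficient matrices with [d] columns form a finite type, so their image is a finite set. *)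
Definition box d : {fset 'rV[{poly F}]_s} :=
  [fset (\row_i rVpoly (row i M)) | M : 'M[F]_(s, d)]%fset.

Lemma in_box d f : (f \in box d) = [forall i, (size (f ord0 i) <= d)%N].
Proof.
apply/imfsetP/forallP => [[M _ ->] i|h].
  by rewrite mxE size_poly.
exists (\matrix_i poly_rV (f ord0 i)) => //; apply/rowP => i.
by rewrite mxE rowK poly_rV_K.
Qed.

Hypothesis li : linear_indep (fun i => w ord0 i).

Lemma box_bound (B : R) : exists d, forall f, abs (pairing f w) <= B -> f \in box d.
Proof.
have [c c0 hc] := linear_indep_bound li.
exists (Num.bound (B / c)) => f fB; rewrite in_box; apply/forallP => i.
rewrite -(ler_nat R); apply: le_trans (size_le_abs _) _.
have h : abs (Aemb C (f ord0 i)) <= B / c.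
  rewrite ler_pdivlMr // mulrC; apply: le_trans fB.
  exact: (hc (fun j => FracField.tofrac (f ord0 j))).
by apply/ltW/(le_lt_trans h)/archi_boundP/(le_trans _ h)/Cinfty_abs_ge0.
Qed.

Lemma escapes_pairing : escapes setT (fun f => pairing f w).
Proof. by move=> B; have [d hd] := box_bound B; exists (box d) => f _ /hd. Qed.

Lemma pairing_eq0 f : pairing f w = 0 -> f = 0.
Proof.
move=> f0; have [c c0 hc] := linear_indep_bound li.
apply/rowP => i; rewrite mxE; apply/eqP; rewrite -size_poly_eq0 -leqn0 -(ler_nat R).
apply: le_trans (size_le_abs _) _; rewrite -(ler_pM2l c0) mulr0 -(abs0 C) -f0.
exact: (hc (fun j => FracField.tofrac (f ord0 j))).
Qed.

Lemma pairing_inj : injective (fun f => pairing f w).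
Proof.
move=> f g /eqP; rewrite -subr_eq0 -pairingB => /eqP /pairing_eq0 /eqP.
by rewrite subr_eq0 => /eqP.
Qed.

Definition lattice_box d : {fset C} := [fset pairing f w | f in box d]%fset.

Lemma lattice_box_lattice d l : l \in lattice_box d -> lattice w l.
Proof. by case/imfsetP => f _ ->; exists f. Qed.

Lemma lattice_box0 d : 0 \in lattice_box d.
Proof.
apply/imfsetP; exists 0; last by rewrite pairing0.
by rewrite /= in_box; apply/forallP => i; rewrite mxE size_poly0.
Qed.

Lemma lattice_boxB d a b :
  a \in lattice_box d -> b \in lattice_box d -> a - b \in lattice_box d.
Proof.
case/imfsetP=> f /=; rewrite in_box => /forallP fd ->.
case/imfsetP=> g /=; rewrite in_box => /forallP gd ->.
apply/imfsetP; exists (f - g); last by rewrite pairingB.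
rewrite /= in_box; apply/forallP => i; rewrite !mxE.
by apply: leq_trans (size_polyD _ _) _; rewrite size_polyN geq_max fd gd.
Qed.

Lemma lattice_box_exhaust (J : {fset C}) : exists N, forall n, (N <= n)%N ->
  forall l, l \in J -> lattice w l -> l \in lattice_box n.
Proof.
have [N hN] := box_bound (\sum_(l <- J) abs l); exists N => n Nn l lJ [f _ fl].
rewrite -fl; apply/imfsetP; exists f => //=; have : f \in box N.
  apply: hN; rewrite fl (big_rem _ lJ) /= lerDl sumr_ge0 // => ? _.
  exact: Cinfty_abs_ge0.
rewrite !in_box => /forallP h; apply/forallP => i; exact: leq_trans (h i) Nn.
Qed.

Lemma escapes_lattice : escapes (lattice w) id.
Proof.
move=> B; have [d hd] := box_bound B; exists (lattice_box d) => _ [f _ <-] /hd h.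
by apply/imfsetP; exists f.
Qed.

Definition power_sum k x := infsum (lattice w) (fun l => ((x + l) ^+ k)^-1).

Lemma power_sumP k x : (0 < k)%N ->
  has_sum (lattice w) (fun l => ((x + l) ^+ k)^-1) (power_sum k x).
Proof. by move=> k0; apply/infsumP/(escapes_vanish _ escapes_lattice). Qed.

Let Pn d := subgroup_poly (lattice_box d).
Let Sn d k x := \sum_(l <- lattice_box d) ((x + l) ^+ k)^-1.

Lemma seq_lim_power_sum k x : (0 < k)%N -> seq_lim (fun d => Sn d k x) (power_sum k x).
Proof.
move=> k0; have := seq_lim_exhaust lattice_box_exhaust (power_sumP x k0).
apply: eq_seq_lim => d; rewrite big_seq_cond /Sn [RHS]big_seq; apply: eq_bigl => l.
case: (boolP (l \in _)) => //= /lattice_box_lattice Ll; exact: mem_set.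
Qed.

Lemma seq_lim_exp x : seq_lim (fun d => (Pn d).[x]) (exp_lattice w x).
Proof.
(* Products are handled with factors [1 + f], hence the sign. *)
have hs : vanish [set l | lattice w l /\ l != 0]%classic (fun l => - x * l^-1).
  apply/has_sum_vanish/has_sumZ/infsumP.
  apply: eq_vanish (vanishS _ (@escapes_vanish _ _ _ 0 1 escapes_lattice isT)) => [l|l []//].
  by rewrite add0r expr1.
have hp : has_prod [set l | lattice w l /\ l != 0]%classic (fun l => 1 - x / l)
    (infprod [set l | lattice w l /\ l != 0]%classic (fun l => 1 - x / l)).
  apply: (@xgetPex _ _ (has_prod _ _)); have [p hp] := has_prod_exists hs.
  exists p => e /hp [J hJ]; exists J => J' /hJ.
  by under eq_bigr do rewrite mulNr.
have hV J : exists N, forall n, (N <= n)%N -> forall i : C, i \in (J : {fset C}) ->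
    lattice w i /\ i != 0 -> i \in lattice_box n.
  have [N hN] := lattice_box_exhaust J; exists N => n /hN h i iJ [+ _]; exact: h.
have := seq_limM (seq_lim_cst x) (seq_lim_exhaust hV hp).
apply: eq_seq_lim => d; rewrite /Pn horner_subgroup_poly; congr (_ * _).
rewrite big_seq_cond [RHS]big_seq_cond; apply: eq_bigl => l.
case: (boolP (l \in lattice_box d)) => //= /lattice_box_lattice Ll.
by apply/idP/idP => [/set_mem[]|l0] //; apply: mem_set.
Qed.

Lemma lattice_neq x l : ~ lattice w x -> lattice w l -> x + l != 0.
Proof.
move=> nx [f _ <-]; apply/eqP => x0; apply: nx; exists (- f) => //.
by rewrite pairingN; apply/eqP; rewrite eq_sym -addr_eq0 x0.
Qed.

Lemma box_power_sums d x m : ~ lattice w x ->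
  (Pn d).[x] * Sn d m.+1 x =
    (m == 0%N)%:R + \sum_(j < m) (Pn d)`_j.+1 * Sn d (m - j)%N x.
Proof.
move=> nx; apply: (subgroup_power_sums (V := lattice_box d)).
- exact: fset_uniq.
- exact: lattice_box0.
- exact: lattice_boxB.
- by move=> l /lattice_box_lattice /(lattice_neq nx).
Qed.

(** The limit of the recurrence for [m = 0]. It also shows that the exponential has no zero off the
    lattice. *)
Lemma exp_power_sum1 x : ~ lattice w x -> exp_lattice w x * power_sum 1 x = 1.
Proof.
move=> nx; apply: seq_lim_uniq (seq_limM (seq_lim_exp x) (seq_lim_power_sum x _)) _ => //.
apply: eq_seq_lim (seq_lim_cst 1) => d.
by rewrite box_power_sums // big_ord0 addr0.
Qed.

(* At a single point off the lattice the recurrence for the power sums can be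
   solved for the coefficients of the exponential, which therefore converge. *)
Lemma coef_box_lim x0 : ~ lattice w x0 -> forall m,
  exists c, seq_lim (fun d => (Pn d)`_m.+1) c.
Proof.
move=> nx; elim/ltn_ind => m IH.
have /choice[c hc] : forall j : 'I_m, exists c, seq_lim (fun d => (Pn d)`_j.+1) c.
  by move=> j; apply: IH.
have he := seq_lim_exp x0.
(* In the recurrence for [m.+1] the last term is the coefficient sought times the first power sum,
   whose inverse is the value of the polynomial at [x0]. *)
exists (exp_lattice w x0 * (exp_lattice w x0 * power_sum m.+2 x0 -
  \sum_(j < m) c j * power_sum (m.+1 - j)%N x0)).
apply: eq_seq_lim (seq_limM he (seq_limD (seq_limM he (seq_lim_power_sum x0 _))
  (seq_limN (seq_lim_sum _ _)))); last first.
- move=> j; apply: seq_limM (hc j) (seq_lim_power_sum x0 _).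
  by rewrite subn_gt0 ltnS ltnW.
- by [].
move=> d; rewrite box_power_sums // add0r big_ord_recr /= addrAC subrr add0r.
rewrite subSnn mulrCA; have -> : (Pn d).[x0] * Sn d 1 x0 = 1.
  by rewrite box_power_sums // big_ord0 addr0.
by rewrite mulr1.
Qed.

(** The point [x0] provides the limits [c] of the coefficients. Then the limit recurrence, divided
    by the exponential, expresses the power sum of order [k] through lower ones, by strong induction
    as a polynomial in [t_lattice]. *)
Lemma Goss_exists x0 k : ~ lattice w x0 -> (0 < k)%N -> exists G, is_Goss w k G.
Proof.
move=> nx0 k0; have /choice[c hc] := coef_box_lim nx0.
suff [G hG] : exists G : {poly C},
    forall x, ~ lattice w x -> power_sum k x = G.[t_lattice w x].
  by exists G => x /hG <-; apply: power_sumP.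
elim/ltn_ind: k k0 => -[//|m] IH _.
have /choice[G hG] : forall j : 'I_m, exists G : {poly C},
    forall x, ~ lattice w x -> power_sum (m - j) x = G.[t_lattice w x].
  by move=> j; apply: IH; rewrite ?ltnS ?leq_subr // subn_gt0.
exists ('X * ((m == 0%N)%:R%:P + \sum_(j < m) c j *: G j)) => x nx.
have h : exp_lattice w x * power_sum m.+1 x =
    (m == 0%N)%:R + \sum_(j < m) c j * power_sum (m - j)%N x.
  apply: seq_lim_uniq (seq_limM (seq_lim_exp x) (seq_lim_power_sum x _)) _ => //.
  apply: eq_seq_lim (fun d => esym (box_power_sums d m nx)) _.
  apply: seq_limD (seq_lim_cst _) (seq_lim_sum _ _) => j.
  by apply: seq_limM (hc j) (seq_lim_power_sum x _); rewrite subn_gt0.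
have e0 : exp_lattice w x != 0.
  by apply: contra_eq_neq (exp_power_sum1 nx) => ->; rewrite mul0r eq_sym oner_neq0.
rewrite hornerM hornerX hornerD hornerC horner_sum.
rewrite (eq_bigr (fun j : 'I_m => c j * power_sum (m - j)%N x)) => [|j _].
  by rewrite -h /t_lattice mulKf.
by rewrite hornerZ hG.
Qed.

(** As [x] lies off the lattice, a Goss polynomial exists and [Goss] is not the default value 0. The
    lattice sum is reindexed by vectors because the pairing is injective. *)
Lemma has_sum_Goss x k : ~ lattice w x -> (0 < k)%N ->
  has_sum setT (fun f => ((x + pairing f w) ^+ k)^-1) (Goss w k).[t_lattice w x].
Proof.
move=> nx k0.
have hs := infsumP (@escapes_vanish _ _ _ x k escapes_pairing k0).
have : is_Goss w k (Goss w k) by apply: xgetPex (Goss_exists nx k0).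
have := @has_sum_image _ _ _ _ _ (fun f => pairing f w) setT
  (fun l => ((x + l) ^+ k)^-1) _ (fun f g _ _ => @pairing_inj f g) hs.
by move=> h /(_ x nx) /(fset_lim_uniq h) <-.
Qed.

End Lattice.

(** * Sums over chains *)

Section ChainSums.

Variables (R : realType) (F : finFieldType) (C : Cinfty R F).

Section OneType.

Variables (T : choiceType) (x0 : T) (D : pred T) (gt : rel T) (w : nat -> T -> C).

(** The condition [c] bears on the first entry only; for [c := gt x] these are the chains that [x]
    can be prepended to. *)
Definition chain m (c : pred T) : set (seq T) :=
  [set s | [/\ size s = m, sorted gt s, all D s & if s is x :: _ then c x else true]]%classic.

Definition chain_weight (a : seq nat) (s : seq T) : C :=
  \prod_(j < size a) w (nth 0%N a j) (nth x0 s j).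

Definition chain_sum (a : seq nat) (c : pred T) : C :=
  infsum (chain (size a) c) (chain_weight a).

Lemma chain_weight_cons k a x s :
  chain_weight (k :: a) (x :: s) = w k x * chain_weight a s.
Proof. by rewrite /chain_weight big_ord_recl. Qed.

Lemma chain_sum_nil c : chain_sum [::] c = 1.
Proof.
apply: has_sum_infsum.
have -> : chain 0 c = [set [::]]%classic.
  by apply/seteqP; split=> [s [/size0nil ->]|_ ->].
have -> : 1 = chain_weight [::] [::] by rewrite /chain_weight big_ord0.
exact: has_sum1.
Qed.

Lemma eq_chain_sum a c c' : {in D, c =1 c'} -> chain_sum a c = chain_sum a c'.
Proof.
move=> cc; rewrite /chain_sum; congr infsum; apply/seteqP; split=> -[|x s] [//= h1 h2 h3 h4].
  by split=> //=; rewrite -cc //; case/andP: h3.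
by split=> //=; rewrite cc //; case/andP: h3.
Qed.

Hypothesis w_vanish : forall k, (0 < k)%N -> vanish [set x | D x]%classic (w k).

(** Outside a finite product set either the head weight or the tail weight is small, and the other
    factor is bounded. *)
Lemma chain_weight_vanish a : all (fun k => 0 < k)%N a ->
  vanish [set s | size s = size a /\ all D s]%classic (chain_weight a).
Proof.
elim: a => [_ e e0|k a IH /= /andP[k0 /IH{}IH]].
  by exists [fset [::]]%fset => s [/size0nil -> _]; rewrite inE.
have hw := w_vanish k0.
have [B1 B10 hB1] := vanish_bound hw; have [B2 B20 hB2] := vanish_bound IH.
move=> e e0; have [J1 hJ1] := hw _ (divr_gt0 e0 B20).
have [J2 hJ2] := IH _ (divr_gt0 e0 B10).
exists [fset x :: s | x in J1, s in J2]%fset => -[|x s] [//= [sz] /andP[Dx Ds]] xs.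
rewrite chain_weight_cons Cinfty_absM.
have [xJ|/(hJ1 _ Dx) hx] := boolP (x \in J1).
  have [sJ|/(hJ2 _ (conj sz Ds)) hs] := boolP (s \in J2).
    by move: xs; rewrite in_imfset2.
  apply: le_lt_trans (ler_wpM2r (Cinfty_abs_ge0 _) (hB1 _ Dx)) _.
  by rewrite mulrC -ltr_pdivlMr.
apply: le_lt_trans (ler_wpM2l (Cinfty_abs_ge0 _) (hB2 _ (conj sz Ds))) _.
by rewrite -ltr_pdivlMr.
Qed.

Lemma chain_sumP a c : all (fun k => 0 < k)%N a ->
  has_sum (chain (size a) c) (chain_weight a) (chain_sum a c).
Proof. by move=> /chain_weight_vanish h; apply/infsumP/vanishS/h => s []. Qed.

(** Summation by fibres over the head of the chain; this drives all inductions on the index. *)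
Lemma chain_sum_cons k a c : all (fun k => 0 < k)%N (k :: a) ->
  has_sum [set x | D x && c x]%classic (fun x => w k x * chain_sum a (gt x))
    (chain_sum (k :: a) c).
Proof.
move=> ka0; have /andP[_ a0] := ka0.
apply: (has_sum_fibers (p := head x0) (chain_sumP c ka0)).
  by move=> [|x s] [//= _ _ /andP[-> _] ->].
move=> x /andP[Dx cx].
have -> : [set s | chain (size (k :: a)) c s /\ head x0 s = x]%classic =
    [set x :: s | s in chain (size a) (gt x)]%classic.
  apply/seteqP; split=> [[|y s] [[//= [sz] ps /andP[_ Ds] _] yx]|_ [s [sz ps Ds cs] <-]].
    exists s; rewrite -?yx //; split=> //; first exact: path_sorted ps.
    by case: s ps {sz Ds} => //= u s /andP[].
  split=> //; split=> //=; rewrite ?sz ?Dx //.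
  by case: s ps cs {sz Ds} => //= u s -> ->.
apply: has_sum_image; first by move=> s t _ _ [].
apply: eq_has_sum (has_sumZ (w k x) (chain_sumP (gt x) a0)) => s _.
by rewrite /= chain_weight_cons.
Qed.

End OneType.

(** The image of [h] is closed downwards for [gt], so a chain whose head lies in it stays in it.
    Induction on the index then transports the sum head by head. *)
Lemma chain_sum_embed (T T' : choiceType) (x0 : T) (x0' : T') (D : pred T) (D' : pred T')
    (gt : rel T) (gt' : rel T') (w : nat -> T -> C) (w' : nat -> T' -> C) (h : T' -> T) :
  injective h ->
  (forall k, (0 < k)%N -> vanish [set x | D x]%classic (w k)) ->
  (forall k, (0 < k)%N -> vanish [set x | D' x]%classic (w' k)) ->
  (forall u, D (h u) = D' u) -> (forall u v, gt (h u) (h v) = gt' u v) ->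
  (forall k u, w k (h u) = w' k u) ->
  (forall u y, gt (h u) y -> exists v, y = h v) ->
  forall a (c : pred T) (c' : pred T'), all (fun k => 0 < k)%N a ->
  (forall x, c x -> exists u, x = h u) -> (forall u, c (h u) = c' u) ->
  chain_sum x0 D gt w a c = chain_sum x0' D' gt' w' a c'.
Proof.
move=> hI hw hw' hD hgt hww him; elim=> [|k a IH] c c' ka0 hc hcc.
  by rewrite !chain_sum_nil.
have /andP[_ a0] := ka0.
apply: fset_lim_uniq (chain_sum_cons x0 gt hw c ka0) _.
have -> : [set x | D x && c x]%classic = [set h u | u in [set u | D' u && c' u]]%classic.
  apply/seteqP; split=> [x /andP[Dx cx]|_ [u /andP[Du cu] <-]].
    have [u xu] := hc x cx; exists u => //=.
    by rewrite -hD -hcc -xu Dx.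
  by rewrite /= hD hcc Du.
apply: has_sum_image; first by move=> u v _ _ /hI.
apply: eq_has_sum (chain_sum_cons x0' gt' hw' c' ka0) => u _ /=.
rewrite hww; congr (_ * _); apply/esym/IH => // y; exact: him.
Qed.

End ChainSums.

(** * The order on vectors, split at the first coordinate *)

Section RowOrder.

Variable F : finFieldType.

Definition row_cons (V : zmodType) n (h : V) (u : 'rV[V]_n.+1) : 'rV[V]_n.+2 :=
  \row_j if unlift ord0 j is Some k then u ord0 k else h.

Lemma row_cons0 (V : zmodType) n (h : V) (u : 'rV[V]_n.+1) :
  row_cons h u ord0 ord0 = h.
Proof. by rewrite mxE unlift_none. Qed.

Lemma row_consS (V : zmodType) n (h : V) (u : 'rV[V]_n.+1) j :
  row_cons h u ord0 (lift ord0 j) = u ord0 j.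
Proof. by rewrite mxE liftK. Qed.

Lemma row_consK (V : zmodType) n (x : 'rV[V]_n.+2) :
  row_cons (x ord0 ord0) (col' ord0 x) = x.
Proof. by apply/rowP => j; rewrite mxE; case: unliftP => [k ->|->]; rewrite ?mxE. Qed.

Lemma row_cons_inj (V : zmodType) n (h : V) : injective (@row_cons V n h).
Proof. by move=> u v /rowP uv; apply/rowP => j; rewrite -(row_consS h) uv row_consS. Qed.

(** The recursion common to [vpos] and [vgt]: the comparison is decided at the first coordinate or
    passed on to the others. *)
Lemma lex_exists_recl n (P Q : pred 'I_n.+1) :
  [exists i : 'I_n.+1, [forall j : 'I_n.+1, (j < i)%N ==> P j] && Q i] =
  Q ord0 || P ord0 && [exists i : 'I_n,
     [forall j : 'I_n, (j < i)%N ==> P (lift ord0 j)] && Q (lift ord0 i)].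
Proof.
apply/existsP/orP => [[i]|[Q0|/andP[P0 /existsP[i /andP[/forallP Pi Qi]]]]].
- have [k ->|->] := unliftP ord0 i; last by case/andP; left.
  case/andP => /forallP h Qk; right; rewrite (implyP (h ord0)) //=.
  apply/existsP; exists k; rewrite Qk andbT; apply/forallP => j; apply/implyP => jk.
  by apply: (implyP (h (lift ord0 j))).
- by exists ord0; rewrite Q0 andbT; apply/forallP.
- exists (lift ord0 i); rewrite Qi andbT; apply/forallP => j.
  by have [k ->|->] := unliftP ord0 j; rewrite ?P0 ?implybT //; apply: Pi.
Qed.

Implicit Types h g : {poly F}.

Lemma vpos_cons n h (u : 'rV[{poly F}]_n.+1) :
  vpos (row_cons h u) = (h \is monic) || (h == 0) && vpos u.
Proof.
rewrite /vpos (lex_exists_recl (fun j => row_cons h u ord0 j == 0)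
  (fun i => row_cons h u ord0 i \is monic)) row_cons0; congr (_ || _ && _).
apply: eq_existsb => i; rewrite row_consS; congr (_ && _).
by apply: eq_forallb => j; rewrite row_consS.
Qed.

Lemma vgt_cons n h g (u v : 'rV[{poly F}]_n.+1) :
  vgt (row_cons h u) (row_cons g v) =
  [&& vpos (row_cons h u), vpos (row_cons g v) &
    [|| [&& h \is monic, g \is monic & (size g < size h)%N],
      (h \is monic) && (g == 0) |
      [&& h == 0, g == 0 &
       [exists i : 'I_n.+1,
         [forall j : 'I_n.+1, (j < i)%N ==> (u ord0 j == 0) && (v ord0 j == 0)] &&
         ([&& u ord0 i \is monic, v ord0 i \is monic
            & (size (v ord0 i) < size (u ord0 i))%N]
          || (u ord0 i \is monic) && (v ord0 i == 0))]]]].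
Proof.
rewrite /vgt; congr [&& _, _ & _].
set f := row_cons h u; set k := row_cons g v.
rewrite (lex_exists_recl (fun j => (f ord0 j == 0) && (k ord0 j == 0))
  (fun i => [&& f ord0 i \is monic, k ord0 i \is monic
     & (size (k ord0 i) < size (f ord0 i))%N]
     || (f ord0 i \is monic) && (k ord0 i == 0))) /f /k !row_cons0 -!orbA.
congr [|| _, _ | _]; rewrite -andbA; congr [&& _, _ & _].
apply: eq_existsb => i; rewrite !row_consS; congr (_ && _).
by apply: eq_forallb => j; rewrite !row_consS.
Qed.

(** The two cases for the first coordinate of [y], monic of smaller degree or zero, merge into one
    inequality because the zero polynomial has size 0. *)
Lemma vgt_cons_monic n h (u : 'rV[{poly F}]_n.+1) (y : 'rV[{poly F}]_n.+2) :
  h \is monic -> vpos y -> vgt (row_cons h u) y = (size (y ord0 ord0) < size h)%N.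
Proof.
rewrite -(row_consK y); move: (y ord0 ord0) (col' ord0 y) => g v hm yp.
have h0 : h != 0 by rewrite monic_neq0.
rewrite row_cons0 vgt_cons yp vpos_cons hm (negbTE h0) /= orbF.
move: yp; rewrite vpos_cons; have [gm _|_ /= /andP[/eqP -> _]] := boolP (g \is monic).
  by rewrite (negbTE (monic_neq0 gm)) orbF.
by rewrite eqxx size_poly0 size_poly_gt0.
Qed.

Lemma vgt_cons0 n (u v : 'rV[{poly F}]_n.+1) :
  vgt (row_cons 0 u) (row_cons 0 v) = vgt u v.
Proof. by rewrite vgt_cons !vpos_cons eqxx monicE lead_coef0 eq_sym oner_eq0. Qed.

Lemma vgt_cons0_inv n (u : 'rV[{poly F}]_n.+1) (y : 'rV[{poly F}]_n.+2) :
  vgt (row_cons 0 u) y -> y = row_cons 0 (col' ord0 y).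
Proof.
rewrite -{1}(row_consK y) vgt_cons monicE lead_coef0 eq_sym oner_eq0 /=.
by case/and5P => _ _ _ /eqP y0 _; rewrite -{1}(row_consK y) y0.
Qed.

End RowOrder.

Lemma pairing_cons (R : realType) (F : finFieldType) (C : Cinfty R F) n
    (h : {poly F}) (u : 'rV[{poly F}]_n.+1) (z : 'rV[C]_n.+2) :
  pairing (row_cons h u) z = Aemb C h * z ord0 ord0 + pairing u (col' ord0 z).
Proof.
rewrite /pairing big_ord_recl row_cons0; congr (_ + _).
by apply: eq_bigr => j _; rewrite row_consS mxE.
Qed.

(** * Splitting the chains by their monic first coordinates *)

Section Decomposition.

Variables (R : realType) (F : finFieldType) (C : Cinfty R F).

Local Notation positive := (all (fun k => 0 < k)%N).
Local Notation size_gt := (fun g h : {poly F} => (size h < size g)%N).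

Definition row_weight s (z : 'rV[C]_s) k (f : 'rV[{poly F}]_s) : C :=
  (pairing f z ^+ k)^-1.

Lemma row_weight_vanish s (z : 'rV[C]_s) D k : linear_indep (fun i => z ord0 i) ->
  (0 < k)%N -> vanish D (row_weight z k).
Proof.
move=> li k0; apply: vanishS (_ : (D `<=` setT)%classic) _ => //.
apply: eq_vanish (escapes_vanish 0 (escapes_pairing li) k0) => f _.
by rewrite add0r.
Qed.

Lemma EisensteinE s (z : 'rV[C]_s) a :
  Eisenstein a z = chain_sum 0 (@vpos F s) (@vgt F s) (row_weight z) a xpredT.
Proof.
case: a => [|k a]; first by rewrite chain_sum_nil.
rewrite /Eisenstein /chain_sum; congr infsum.
  by apply/seteqP; split=> [f [sf fs fa]|f [sf fs fa _]] //; split=> //; case: f {sf fs fa}.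
apply/funext => f; rewrite /chain_weight; elim/big_rec2: _ => [|i x y _ <-].
  by rewrite invr1.
by rewrite invfM.
Qed.

Variables (n : nat) (z : 'rV[C]_n.+2).
Hypothesis li : linear_indep (fun i => z ord0 i).

Let z' : 'rV[C]_n.+1 := col' ord0 z.

Definition Goss_weight k (h : {poly F}) : C :=
  (Goss z' k).[t_lattice z' (Aemb C h * z ord0 ord0)].

Lemma linear_indep_col' : linear_indep (fun i => z' ord0 i).
Proof.
have := linear_indep_lift li; congr linear_indep.
by apply/funext => i; rewrite mxE.
Qed.

(** Otherwise some vector [row_cons h (- u)] would pair to 0 with [z], contradicting
    independence. *)
Lemma monic_notin_lattice h : h \is monic -> ~ lattice z' (Aemb C h * z ord0 ord0).
Proof.
move=> hm [u _ uh]; have := @pairing_eq0 _ _ _ _ _ li (row_cons h (- u)).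
rewrite pairing_cons -uh pairingN subrr => /(_ erefl).
move/rowP/(_ ord0); rewrite row_cons0 mxE => h0.
by move: hm; rewrite h0 monicE lead_coef0 eq_sym oner_eq0.
Qed.

Lemma row_weight_fiber h (D : set 'rV[{poly F}]_n.+2) k :
  h \is monic -> (0 < k)%N -> (forall u, D (row_cons h u)) ->
  has_sum [set x | D x /\ x ord0 ord0 = h]%classic (row_weight z k) (Goss_weight k h).
Proof.
move=> hm k0 hD.
have -> : [set x | D x /\ x ord0 ord0 = h]%classic =
    [set row_cons h u | u in setT]%classic.
  apply/seteqP; split=> [x [_ xh]|_ [u _ <-]]; last by split; rewrite ?row_cons0.
  by exists (col' ord0 x) => //; rewrite -xh row_consK.
apply: has_sum_image => [u v _ _|]; first exact: row_cons_inj.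
apply: eq_has_sum (has_sum_Goss linear_indep_col' (monic_notin_lattice hm) k0) => u _.
by rewrite /row_weight /= pairing_cons.
Qed.

(** These values are the fibre sums of a summable family, the row weights of vectors with monic
    first coordinate, so they are summable themselves. *)
Lemma Goss_weight_vanish k : (0 < k)%N ->
  vanish [set h : {poly F} | h \is monic]%classic (Goss_weight k).
Proof.
pose D := [set x : 'rV[{poly F}]_n.+2 | x ord0 ord0 \is monic]%classic.
move=> k0; have hv := @row_weight_vanish _ z D k li k0.
apply: (has_sum_vanish (l := infsum _ _)).
apply: (has_sum_fibers (p := fun x : 'rV_n.+2 => x ord0 ord0) (infsumP hv)) => //.
by move=> h hm; apply: row_weight_fiber => // u; rewrite /D /= row_cons0.
Qed.

Let E a c := chain_sum 0 (@vpos F n.+2) (@vgt F n.+2) (row_weight z) a c.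
Let E' a := chain_sum 0 (@vpos F n.+1) (@vgt F n.+1) (row_weight z') a xpredT.
Let M a c := chain_sum 0 (fun h : {poly F} => h \is monic) size_gt Goss_weight a c.

(** Everything below a vector with first coordinate 0 has first coordinate 0, so [row_cons 0] embeds
    the chains of lower rank. *)
Lemma chain_sum_first0 a : positive a -> E a (fun x => x ord0 ord0 == 0) = E' a.
Proof.
move=> a0; apply: (@chain_sum_embed _ _ _ _ _ _ _ _ _ _ _ _ _ (row_cons 0)) a0 _ _.
- exact: row_cons_inj.
- by move=> k; apply: row_weight_vanish li.
- by move=> k; apply: row_weight_vanish linear_indep_col'.
- by move=> u; rewrite vpos_cons eqxx monicE lead_coef0 eq_sym oner_eq0.
- exact: vgt_cons0.
- by move=> k u; rewrite /row_weight pairing_cons /Aemb !rmorph0 mul0r add0r.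
- by move=> u y /vgt_cons0_inv ->; eexists.
- by move=> x /eqP x0; exists (col' ord0 x); rewrite -{1}(row_consK x) x0.
- by move=> u; rewrite row_cons0 eqxx.
Qed.

(** The bound [lim] makes the induction go through: after a head with first coordinate [h], the tail
    is bounded by [size h]. The condition [lim 0] admits the vectors with first coordinate 0. *)
Lemma chain_sum_decomposition a (lim : pred nat) : positive a -> lim 0%N ->
  E a (fun x => lim (size (x ord0 ord0))) =
  \sum_(i < (size a).+1) E' (drop i a) * M (take i a) (fun h => lim (size h)).
Proof.
elim: a lim => [|k a IH] lim ka0 lim0.
  by rewrite big_ord1 /E /E' /M !chain_sum_nil mulr1.
have /andP[k0 a0] := ka0.
have wv k' : (0 < k')%N -> vanish [set x | vpos x]%classic (row_weight z k').
  exact: row_weight_vanish.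
pose f x := row_weight z k x * E a (vgt x).
have hE c : has_sum [set x | vpos x && c x]%classic f (E (k :: a) c).
  exact: (chain_sum_cons 0 _ wv).
pose N := [set x : 'rV[{poly F}]_n.+2 |
  x ord0 ord0 \is monic /\ lim (size (x ord0 ord0))]%classic.
have posN x : N x -> vpos x.
  by case=> xm _; rewrite -(row_consK x) vpos_cons xm.
have NS : (N `<=` [set x | vpos x && lim (size (x ord0 ord0))])%classic.
  by move=> x Nx; rewrite /= posN //; case: Nx.
have hN := infsumP (vanishS NS (has_sum_vanish (hE _))).
(* The head has first coordinate 0, which gives the series of lower rank, or a monic one, which puts
   it in [N]. *)
have -> : E (k :: a) (fun x => lim (size (x ord0 ord0))) = E' (k :: a) + infsum N f.
  apply: fset_lim_uniq (hE _) _; rewrite -(chain_sum_first0 ka0).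
  have -> : [set x | vpos x && lim (size (x ord0 ord0))]%classic =
      ([set x : 'rV[{poly F}]_n.+2 | vpos x && (x ord0 ord0 == 0%R)] `|` N)%classic.
    apply/seteqP; split=> x /=; last first.
      case=> [/andP[-> /eqP ->]|/NS//]; by rewrite size_poly0.
    case/andP=> xp xl; rewrite xp; move: (xp).
    by rewrite -{1}(row_consK x) vpos_cons => /orP[xm|/andP[-> _]]; [right|left].
  apply: has_sumU => // x /andP[_ /eqP x0] [xm _].
  by move: xm; rewrite x0 monicE lead_coef0 eq_sym oner_eq0.
rewrite big_ord_recl drop0 take0 [M [::] _]chain_sum_nil mulr1; congr (_ + _).
(* [g h] is the sum of [f] over the vectors of [N] with first coordinate [h]. Its summands, summed
   over [h], are the remaining terms of the formula, with [i] shifted by one. *)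
pose g h := Goss_weight k h *
  \sum_(i < (size a).+1) E' (drop i a) * M (take i a) (size_gt h).
apply: (@fset_lim_uniq _ _ _ _ _ _ _
  (_ : has_sum [set h : {poly F} | (h \is monic) && lim (size h)]%classic g _)).
  apply: (has_sum_fibers (p := fun x : 'rV_n.+2 => x ord0 ord0) hN) => [x []|h /andP[hm hl]].
    by move=> /= -> ->.
  have hNu u : N (row_cons h u) by rewrite /N /= row_cons0.
  have := has_sumZ (\sum_(i < (size a).+1) E' (drop i a) * M (take i a) (size_gt h))
    (row_weight_fiber hm k0 hNu).
  rewrite mulrC; apply: eq_has_sum => x [_ xh].
  (* The bound admits 0 because a monic [h] has positive size. *)
  rewrite mulrC -(IH (fun m => (m < size h)%N)) ?size_poly_gt0 ?monic_neq0 //.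
  congr (_ * _); apply: eq_chain_sum => y yp.
  by rewrite -(row_consK x) xh vgt_cons_monic.
have hM (i : 'I_(size a).+1) :
  has_sum [set h : {poly F} | (h \is monic) && lim (size h)]%classic
    (fun h => E' (drop i a) * (Goss_weight k h * M (take i a) (size_gt h)))
    (E' (drop i a) * M (k :: take i a) (fun h => lim (size h))).
  apply: has_sumZ; apply: (chain_sum_cons 0 _ Goss_weight_vanish) => /=.
  by rewrite k0; apply/allP => m /mem_take; apply/allP.
apply: eq_has_sum (has_sum_sum (index_enum _) hM) => h _.
by rewrite /g mulr_sumr; apply: eq_bigr => i _; rewrite mulrCA.
Qed.

End Decomposition.

Lemma Omega_linear_indep (R : realType) (F : finFieldType) (C : Cinfty R F) n
  (z : 'rV[C]_n.+1) : Omega z -> linear_indep (fun i => z ord0 i).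
Proof.
move=> [h _] c Kc cz i.
have := h (\row_j c j) _ _; move=> /(_ _ _)/rowP/(_ i); rewrite !mxE; apply.
  by move=> j; rewrite mxE.
by rewrite -[RHS]cz; apply: eq_bigr => j _; rewrite mxE.
Qed.

(** The rank is [n.+2], and [col' ord0] drops the first coordinate of [z]. The formula is the
    unbounded case of the decomposition with the term [i = 0] set apart. *)
Theorem proposition2p3 (R : realType) (F : finFieldType) (C : Cinfty R F)
    (n : nat) (a : seq nat) (z : 'rV[C]_n.+2) :
  a != [::] -> all (fun k => 0 < k)%N a -> Omega z ->
  let z' : 'rV[C]_n.+1 := col' ord0 z in
  Eisenstein a z =
    Eisenstein a z' +
    \sum_(1 <= i < (size a).+1)
      Eisenstein (drop i a) z' *
      infsum (@monic_chain F i)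
        (fun f : seq {poly F} =>
           \prod_(j < i)
             (Goss z' (nth 0%N a j)).[t_lattice z' (Aemb C f`_j * z ord0 ord0)]).
Proof.
move=> _ a0 /Omega_linear_indep li z'.
rewrite EisensteinE (chain_sum_decomposition (lim := xpredT) li a0) //.
rewrite big_ord_recl drop0 take0 chain_sum_nil mulr1 -EisensteinE; congr (_ + _).
rewrite big_add1 big_mkord; apply: eq_bigr => i _.
rewrite -EisensteinE; congr (_ * _); rewrite /chain_sum.
have si : size (take i.+1 a) = i.+1 by rewrite size_takel.
have -> : chain (fun h => h \is monic) (fun g h : {poly F} => (size h < size g)%N)
    (size (take (lift ord0 i) a)) xpredT = monic_chain i.+1.
  rewrite si; apply/seteqP; split=> [f [sf fs fm _]|f [sf fm fs]]; first by split.
  by split=> //; case: f {sf fm fs}.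
congr infsum; apply/funext => f; rewrite /chain_weight si.
by apply: eq_bigr => j _; rewrite nth_take.
Qed.
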